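(* Let $R$ be a commutative Noetherian ring of prime characteristic $p$ and let $\mathfrak{a}$ be a proper ideal of $R$. Suppose that $(\mathfrak{a}_n)_{n\in\mathbb{N}_0}$ is an $f$-sequence of ideals of $R$ such that $\mathfrak{a}^{[p^n]}\subseteq\mathfrak{a}_n\subseteq(\mathfrak{a}^{[p^n]})^*$ for all $n\in\mathbb{N}_0$. Suppose that the ideal $\mathfrak{A}$ of $R^{\infty}$ to which $(\mathfrak{a}_n)_{n\in\mathbb{N}_0}$ corresponds has a primary decomposition. Then (i) the $f$-sequence $(\mathfrak{a}_n)_{n\in\mathbb{N}_0}$ has linear growth of primary decompositions; (ii) the set $\bigcup_{n\in\mathbb{N}_0}\operatorname{ass}\mathfrak{a}_n$ is finite; furthermore, if $R$ has a $p^{m_0}$-weak test element, for some $m_0\in\mathbb{N}_0$, then, in addition, (iii) $\mathfrak{a}^*S^{-1}R=(\mathfrak{a}S^{-1}R)^*$ for every multiplicatively closed subset $S$ of $R$; (iv) the ideal of $R^{\infty}$ to which the $f$-sequence $\big((\mathfrak{a}^{[p^n]})^*\big)_{n\in\mathbb{N}_0}$ corresponds has a primary decomposition, so that the $f$-sequence $\big((\mathfrak{a}^{[p^n]})^*\big)_{n\in\mathbb{N}_0}$ has linear growth of primary decompositions; and (v) $\bigcup_{n\in\mathbb{N}_0}\operatorname{ass}(\mathfrak{a}^{[p^n]})^*\subseteq\bigcup_{n\in\mathbb{N}_0}\operatorname{ass}\mathfrak{a}_n$, so that the set $\bigcup_{n\in\mathbb{N}_0}\operatorname{ass}(\mathfrak{a}^{[p^n]})^*$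 is finite.
   Context: Rings have identity; $\mathbb{N}_0$ is the set of non-negative integers. $f:R\to R$, $r\mapsto r^p$, is the Frobenius homomorphism. For an ideal $\mathfrak{b}$, $\mathfrak{b}^{[p^n]}$ is the ideal generated by all $p^n$-th powers of elements of $\mathfrak{b}$. For a commutative Noetherian ring $A$ of characteristic $p$, $A^{\circ}$ is the complement in $A$ of the union of the minimal primes of $A$. The tight closure $\mathfrak{b}^*$ of an ideal $\mathfrak{b}$ of $A$ is the ideal of all $r\in A$ for which there exists $c\in A^{\circ}$ with $cr^{p^n}\in\mathfrak{b}^{[p^n]}$ for all $n\gg0$. (Thus $(\mathfrak{a}S^{-1}R)^*$ is computed in $S^{-1}R$.) A $p^{m_0}$-weak test element for $A$ is an element $c\in A^{\circ}$ such that, for every ideal $\mathfrak{b}$ of $A$ and every $r\in A$, one has $r\in\mathfrak{b}^*$ if and only if $cr^{p^n}\in\mathfrak{b}^{[p^n]}$ for all $n\ge m_0$. Perfect closure: a ring of characteristic $p$ is perfect if its Frobenius homomorphism is bijective. $R^{\infty}$ is the perfect closure of $R$: a perfect commutative ring with a ring homomorphism $\psi_0:R\to R^{\infty}$ that is universal for ring homomorphisms from $R$ to perfect commutative rings of characteristic $p$. One has $\ker\psi_0=\sqrt{(0)}$, and each $\alpha\in R^\infty$ satisfies $\alpha^{p^m}\in\psi_0(R)$ for some $m\ge 0$. Put $\overline{r}=\psi_0(r)$, let $\overline{r}^{1/p^n}$ be its unique $p^n$-th root in $R^{\infty}$, and let $\psi_n:R\to R^{\infty}$ be the ring homomorphism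 $\psi_n(r)=\overline{r}^{1/p^n}$. An $f$-sequence of ideals of $R$ is a sequence $(\mathfrak{a}_n)_{n\in\mathbb{N}_0}$ of ideals of $R$ with $f^{-1}(\mathfrak{a}_{n+1})=\mathfrak{a}_n$ for all $n$. The map $\mathfrak{A}\mapsto(\psi_n^{-1}(\mathfrak{A}))_{n\in\mathbb{N}_0}$ is a bijection from the set of ideals of $R^{\infty}$ to the set of $f$-sequences of ideals of $R$, with inverse $(\mathfrak{a}_n)_n\mapsto\bigcup_n\psi_n(\mathfrak{a}_n)$; ''corresponds'' refers to this bijection. The sequence $\big((\mathfrak{a}^{[p^n]})^*\big)_{n\in\mathbb{N}_0}$ is an $f$-sequence. An ideal of a (not necessarily Noetherian) commutative ring has a primary decomposition if it is an intersection of finitely many primary ideals. For an ideal $\mathfrak{b}$ of $R$, $\operatorname{ass}\mathfrak{b}$ is the set of associated primes of $\mathfrak{b}$, i.e. the radicals of the components of a minimal primary decomposition of $\mathfrak{b}$. An $f$-sequence $(\mathfrak{a}_n)_n$ of proper ideals of $R$ has linear growth of primary decompositions if there is a positive integer $h$ such that for every $n\in\mathbb{N}_0$ there is a minimal primary decomposition $\mathfrak{a}_n=\mathfrak{q}_{1,n}\cap\cdots\cap\mathfrak{q}_{k_n,n}$ with $\big((\sqrt{\mathfrak{q}_{i,n}})^{[p^n]}\big)^h\subseteq\mathfrak{q}_{i,n}$ for all $i=1,\ldots,k_n$. *)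

(* Defs.v *)
From mathcomp Require Import all_boot all_algebra.
From mathcomp Require Import boolp classical_sets functions cardinality.

Set Implicit Arguments.
Unset Strict Implicit.
Unset Printing Implicit Defensive.

Import GRing.Theory.
Local Open Scope classical_set_scope.
Local Open Scope ring_scope.

(* Ideals are [Prop]-valued sets rather than MathComp's [idealr], whose
   instances are decidable and proper.  The general notions are given over
   [comPzRingType], which contains the zero ring, because [S^-1 R] is zero as
   soon as [0] belongs to [S]. *)

Section Ideals.
Variable A : comPzRingType.
Implicit Types (I J P Q X : set A).

Definition is_ideal I : Prop :=
  [/\ I 0, forall x y, I x -> I y -> I (x + y) & forall c x, I x -> I (c * x)].

Definition is_proper_ideal I : Prop := is_ideal I /\ ~ I 1.

Definition ideal_gen X : set A := smallest is_ideal X.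

Definition noetherian : Prop :=
  forall I, is_ideal I -> exists s : seq A, I = ideal_gen [set` s].

Definition ideal_mul I J : set A :=
  ideal_gen [set z | exists x y, [/\ I x, J y & z = x * y]].

Definition ideal_pow I (h : nat) : set A := iter h (ideal_mul I) setT.

Definition radical I : set A := [set x | exists m : nat, I (x ^+ m)].

Definition is_prime_ideal P : Prop :=
  is_proper_ideal P /\ forall x y, P (x * y) -> P x \/ P y.

Definition is_primary_ideal Q : Prop :=
  is_proper_ideal Q /\ forall x y, Q (x * y) -> Q x \/ radical Q y.

Definition is_minimal_prime P : Prop :=
  is_prime_ideal P /\ forall P', is_prime_ideal P' -> P' `<=` P -> P' = P.

Definition is_primary_decomposition I (k : nat) (q : 'I_k -> set A) : Prop :=
  (forall i, is_primary_ideal (q i)) /\ I = \bigcap_i q i.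

Definition has_primary_decomposition I : Prop :=
  exists (k : nat) (q : 'I_k -> set A), is_primary_decomposition I q.

Definition is_minimal_primary_decomposition I (k : nat) (q : 'I_k -> set A) :
    Prop :=
  [/\ is_primary_decomposition I q,
      injective (fun i => radical (q i)) &
      forall i, ~ (\bigcap_(j in [set j | j != i]) q j `<=` q i)].

(* Over a Noetherian ring the set of radicals is the same for every minimal
   primary decomposition of [I]. *)
Definition ass I : set (set A) :=
  [set P | exists (k : nat) (q : 'I_k -> set A),
    is_minimal_primary_decomposition I q /\ exists i, P = radical (q i)].

End Ideals.

Arguments noetherian A : clear implicits.

Section TightClosure.
Variables (p : nat) (A : comPzRingType).
Implicit Types (b : set A).

Definition frobenius (x : A) : A := x ^+ p.

Definition frob_pow (n : nat) b : set A :=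
  ideal_gen [set x ^+ (p ^ n)%N | x in b].

(* The set written [A°] in the literature. *)
Definition off_minimal_primes : set A :=
  [set c | forall P, is_minimal_prime P -> ~ P c].

Definition tight_closure b : set A :=
  [set r | exists2 c, off_minimal_primes c &
    exists N : nat, forall n, (N <= n)%N -> frob_pow n b (c * r ^+ (p ^ n)%N)].

(* A [p ^ m0]-weak test element. *)
Definition is_weak_test_element (m0 : nat) (c : A) : Prop :=
  off_minimal_primes c /\
  forall b, is_ideal b -> forall r,
    tight_closure b r <->
    forall n, (m0 <= n)%N -> frob_pow n b (c * r ^+ (p ^ n)%N).

Definition f_sequence (a : nat -> set A) : Prop :=
  (forall n, is_ideal (a n)) /\ forall n, frobenius @^-1` a n.+1 = a n.

Definition linear_growth (a : nat -> set A) : Prop :=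
  [/\ f_sequence a,
      forall n, is_proper_ideal (a n) &
      exists2 h : nat, (0 < h)%N &
        forall n, exists (k : nat) (q : 'I_k -> set A),
          is_minimal_primary_decomposition (a n) q /\
          forall i, ideal_pow (frob_pow n (radical (q i))) h `<=` q i].

End TightClosure.

Arguments frobenius p {A} x.
Arguments off_minimal_primes A : clear implicits.

Section PerfectClosure.
Variable p : nat.

Definition is_perfect (T : comNzRingType) : Prop :=
  p \in [pchar T] /\ bijective (@frobenius p T).

Definition is_perfect_closure (R Rinf : comNzRingType)
    (psi0 : {rmorphism R -> Rinf}) : Prop :=
  is_perfect Rinf /\
  forall (T : comNzRingType) (g : {rmorphism R -> T}), is_perfect T ->
    exists h : {rmorphism Rinf -> T},
      (forall r, h (psi0 r) = g r) /\
      forall h' : {rmorphism Rinf -> T},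
        (forall r, h' (psi0 r) = g r) -> forall x, h' x = h x.

Variables (R Rinf : comNzRingType) (psi0 : {rmorphism R -> Rinf}).

(* The [p ^ n]-th root of [psi0 r]; it exists and is unique when [Rinf] is
   perfect, so the default value [0] is then irrelevant. *)
Definition psi (n : nat) (r : R) : Rinf :=
  xget 0 [set y : Rinf | y ^+ (p ^ n)%N = psi0 r].

Definition corresponds (I : set Rinf) (a : nat -> set R) : Prop :=
  is_ideal I /\ forall n, psi n @^-1` I = a n.

End PerfectClosure.

Section Localization.
Variable R : comPzRingType.

Definition mult_closed (S : set R) : Prop :=
  S 1 /\ forall s t, S s -> S t -> S (s * t).

(* [L] is the ring of fractions [S^-1 R] with structure map [phi]: every
   element is a fraction, and [r/1 = r'/1] iff [u r = u r'] for some [u] in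
   [S]. *)
Definition is_localization (S : set R) (L : comPzRingType)
    (phi : {rmorphism R -> L}) : Prop :=
  [/\ forall s, S s -> exists t, phi s * t = 1,
      forall x, exists r s, S s /\ x * phi s = phi r &
      forall r r', phi r = phi r' <-> exists2 u, S u & u * r = u * r'].

Definition ideal_extension (L : comPzRingType) (phi : {rmorphism R -> L})
    (b : set R) : set L :=
  ideal_gen (phi @` b).

End Localization.

(* Main.v *)
(* Pulling a primary decomposition of [I] back along the ring homomorphisms
   [psi n] gives primary decompositions of all the [a_ n] with the same finite
   set of radicals [psi0 @^-1` P_i].  As [psi n (x ^+ p ^ n) = psi0 x], an [h] with
   [P_i^h] inside the pullback of [Q_i] along [psi0] serves every [n], whence the
   linear growth.  Given a weak test element [c], the tight closures of the
   Frobenius powers of [a] are the pullbacks of the colon ideal of [I] by all the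
   roots [psi m c]; taken componentwise it is primary with the same radicals, or
   the whole ring.  Localization works because [psi n s] avoids [P_i] as soon as
   [psi0 s] does, while one [s] in [S] kills the other components.  Properness is
   Krull's intersection theorem.  Of the perfect closure, only the perfection of
   [Rinf] matters. *)

From HB Require Import structures.
Require Import Defs.
From mathcomp Require Import all_boot all_algebra.
From mathcomp Require Import boolp classical_sets functions cardinality.
From mathcomp Require Import ring zify.

Import GRing.Theory.
Local Open Scope classical_set_scope.
Local Open Scope ring_scope.

(** * Elementary properties of ideals, primes and radicals *)

Section IdealTheory.
Context {A : comPzRingType}.
Implicit Types (I J K P Q X : set A) (x y z : A).

Lemma ideal0 {I} : is_ideal I -> I 0. Proof. by case. Qed.

Lemma idealD {I} : is_ideal I -> forall x y, I x -> I y -> I (x + y).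
Proof. by case. Qed.

Lemma idealMl {I} : is_ideal I -> forall c x, I x -> I (c * x).
Proof. by case. Qed.

Lemma idealMr {I} : is_ideal I -> forall c x, I x -> I (x * c).
Proof. by move=> iI c x Ix; rewrite mulrC; exact: idealMl. Qed.

Lemma idealX {I} : is_ideal I -> forall x m n, (m <= n)%N ->
  I (x ^+ m) -> I (x ^+ n).
Proof. by move=> iI x m n /subnK <- Ix; rewrite exprD; exact: idealMl. Qed.

Lemma ideal_zero : is_ideal [set 0 : A].
Proof. by split=> [//|x y -> ->|c x ->]; rewrite /= ?addr0 ?mulr0. Qed.

Lemma ideal_setI I J : is_ideal I -> is_ideal J -> is_ideal (I `&` J).
Proof.
move=> iI iJ; split=> [|x y [Ix Jx] [Iy Jy]|c x [Ix Jx]].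
- by split; exact: ideal0.
- by split; exact: idealD.
- by split; exact: idealMl.
Qed.

Lemma ideal_colon I x : is_ideal I -> is_ideal [set y | I (x * y)].
Proof.
move=> iI; split=> [|y z Iy Iz|c y Iy] /=.
- by rewrite mulr0; exact: ideal0.
- by rewrite mulrDr; exact: idealD.
- by rewrite mulrCA; exact: idealMl.
Qed.

Lemma ideal_gen_ideal X : is_ideal (ideal_gen X).
Proof.
split=> [|x y Gx Gy|c x Gx] J [iJ XJ].
- exact: ideal0.
- by apply: idealD => //; [exact: Gx|exact: Gy].
- by apply: idealMl => //; exact: Gx.
Qed.

Lemma sub_ideal_gen X : X `<=` ideal_gen X.
Proof. by move=> x Xx J [_]; exact. Qed.

Lemma ideal_gen_sub X I : is_ideal I -> X `<=` I -> ideal_gen X `<=` I.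
Proof. by move=> iI XI x; apply. Qed.

Definition ideal_adjoin I x : set A :=
  [set y | exists2 a, I a & exists r, y = a + r * x].

Lemma ideal_adjoin_ideal I x : is_ideal I -> is_ideal (ideal_adjoin I x).
Proof.
move=> iI; split=> [|_ _ [a Ia [r ->]] [b Ib [s ->]]|c _ [a Ia [r ->]]].
- by exists 0; [exact: ideal0|exists 0; rewrite mul0r addr0].
- by exists (a + b); [exact: idealD|exists (r + s); ring].
- by exists (c * a); [exact: idealMl|exists (c * r); ring].
Qed.

Lemma sub_ideal_adjoin I x : I `<=` ideal_adjoin I x.
Proof. by move=> a Ia; exists a => //; exists 0; rewrite mul0r addr0. Qed.

Lemma ideal_adjoin_mem I x : is_ideal I -> ideal_adjoin I x x.
Proof. by move=> iI; exists 0; [exact: ideal0|exists 1; rewrite mul1r add0r]. Qed.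

Lemma ideal_adjoin_sub I J x : is_ideal J -> I `<=` J -> J x ->
  ideal_adjoin I x `<=` J.
Proof.
move=> iJ IJ Jx _ [a /IJ Ja [r ->]]; apply: idealD => //; exact: idealMl.
Qed.

Lemma prime_ideal {P} : is_prime_ideal P -> is_ideal P. Proof. by case=> -[]. Qed.

Lemma prime1 {P} : is_prime_ideal P -> ~ P 1. Proof. by case=> -[]. Qed.

Lemma primeM {P} : is_prime_ideal P -> forall x y, P (x * y) -> P x \/ P y.
Proof. by case. Qed.

Lemma primeX {P} : is_prime_ideal P -> forall x n, P (x ^+ n) -> P x.
Proof.
move=> pP x; elim=> [|n IH]; first by move/(prime1 pP).
by rewrite exprS => /(primeM pP)[|/IH].
Qed.

Lemma primeXE {P} : is_prime_ideal P -> forall x n, (0 < n)%N -> P (x ^+ n) = P x.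
Proof.
move=> pP x n n_gt0; apply/propext; split; first exact: primeX.
by rewrite -{1}(expr1 x); exact: (idealX (prime_ideal pP)).
Qed.

Lemma prime_prod {P} (T : Type) (r : seq T) (F : T -> A) :
  is_prime_ideal P -> P (\prod_(i <- r) F i) -> exists i, P (F i).
Proof.
move=> pP; elim: r => [|i r IH]; first by rewrite big_nil => /(prime1 pP).
by rewrite big_cons => /(primeM pP)[Pi|/IH//]; exists i.
Qed.

Lemma sub_radical I : I `<=` radical I.
Proof. by move=> x Ix; exists 1%N; rewrite expr1. Qed.

Lemma radical_idem I : radical (radical I) = radical I.
Proof.
apply/seteqP; split; last exact: sub_radical.
by move=> x [m [n]]; rewrite -exprM; exists (m * n)%N.
Qed.

Lemma radicalI I J : is_ideal I -> is_ideal J ->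
  radical (I `&` J) = radical I `&` radical J.
Proof.
move=> iI iJ; apply/seteqP; split=> [x [m [Im Jm]]|x [[m Im] [n Jn]]].
  by split; exists m.
by exists (m + n)%N; split; [apply: (idealX iI) Im|apply: (idealX iJ) Jn];
  rewrite ?leq_addr ?leq_addl.
Qed.

Lemma radical_ideal I : is_ideal I -> is_ideal (radical I).
Proof.
move=> iI; split=> [|x y [m Im] [n In]|c x [m Im]].
- exact/sub_radical/ideal0.
- exists (m + n)%N; rewrite exprDn.
  apply: (big_ind I); [exact: ideal0|exact: idealD|move=> [i /= _] _].
  rewrite -mulr_natr; apply: idealMr => //.
  have [le_in|lt_ni] := leqP i n.
    by apply: idealMr => //; apply: (idealX iI) Im; rewrite -addnBA // leq_addr.
  by apply: idealMl => //; apply: (idealX iI) In; exact: ltnW.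
- by exists m; rewrite exprMn; exact: idealMl.
Qed.

Lemma seq_minimal_below (l : seq (set A)) Q :
  (exists2 P, P \in l & P `<=` Q) ->
  exists P, [/\ P \in l, P `<=` Q & forall P', P' \in l -> P' `<=` P -> P' = P].
Proof.
elim: l => [|P0 l IH]; first by case.
have [/IH[P [Pl PQ Pmin]] _|no] := pselect (exists2 P, P \in l & P `<=` Q).
  have [P0P|nP0P] := pselect (P0 `<=` P).
    exists P0; split; [exact: mem_head|exact: subset_trans PQ|].
    move=> P'; rewrite inE => /predU1P[->//|P'l P'P0].
    apply/seteqP; split=> //.
    by rewrite (Pmin P') //; exact: subset_trans P0P.
  exists P; split=> //; first by rewrite inE Pl orbT.
  by move=> P'; rewrite inE => /predU1P[->//|]; exact: Pmin.
move=> [P Pl PQ]; exists P0.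
have P0E : P = P0.
  by move: Pl; rewrite inE => /predU1P[//|Pl]; case: no; exists P.
rewrite -P0E; split=> //; first by rewrite P0E mem_head.
move=> P'; rewrite inE P0E => /predU1P[//|P'l P'P0].
by case: no; exists P' => //; apply: (subset_trans P'P0); rewrite -P0E.
Qed.

End IdealTheory.

(** * Noetherian rings: existence of primes and finiteness of the minimal ones *)

Section Noetherian.
Context {A : comPzRingType} (noethA : noetherian A).
Implicit Types (I J K P Q X : set A) (x y z : A).

(** Otherwise choice builds a strictly ascending chain [u]. Its union is a finitely generated ideal,
    whose generators already lie in some [u n], where the chain must stop. *)
Lemma noetherian_max (F : set (set A)) : F `<=` @is_ideal A -> F !=set0 ->
  exists2 M, F M & forall N, F N -> M `<=` N -> N = M.
Proof.
move=> iF [M0 FM0]; apply: contrapT => noM.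
have /choice[f fP] M : exists N, F M -> [/\ F N, M `<=` N & ~ N `<=` M].
  have [FM|] := pselect (F M); last by exists M.
  apply: contrapT => noN; apply: noM; exists M => // N FN MN.
  apply/seteqP; split=> //; apply: contrapT => nNM.
  by apply: noN; exists N.
pose u n := iter n f M0.
have Fu n : F (u n) by elim: n => //= n /fP[].
have umono m n : (m <= n)%N -> u m `<=` u n.
  elim: n => [|n IH]; first by rewrite leqn0 => /eqP ->.
  rewrite leq_eqVlt => /predU1P[->//|/IH] um.
  by apply: (subset_trans um) => /=; case: (fP _ (Fu n)).
have iU : is_ideal (\bigcup_n u n).
  split=> [|x y [m _ ux] [n _ uy]|c x [m _ ux]].
  - by exists 0%N => //; exact: (ideal0 (iF _ (Fu 0%N))).
  - exists (m + n)%N => //; apply: (idealD (iF _ (Fu _))).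
      exact: (umono m _ (leq_addr _ _)).
    exact: (umono n _ (leq_addl _ _)).
  - by exists m => //; exact: (idealMl (iF _ (Fu m))).
have [s Us] := noethA _ iU.
have [n sn] : exists n, [set` s] `<=` u n.
  have : [set` s] `<=` \bigcup_n u n by rewrite Us; exact: sub_ideal_gen.
  elim: s {Us} => [|x s IH] sU; first by exists 0%N.
  have [|n sn] := IH; first by move=> y /= ys; apply: sU; rewrite /= inE ys orbT.
  have [m _ um] := sU x (mem_head _ _).
  exists (m + n)%N => y /=; rewrite inE => /predU1P[->|ys].
    exact: (umono m _ (leq_addr _ _)).
  by apply: (umono n _ (leq_addl _ _)); exact: sn.
have Uun : \bigcup_n u n `<=` u n.
  by rewrite Us; apply: ideal_gen_sub => //; exact: iF.
have [_ _] := fP _ (Fu n); apply.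
by apply: subset_trans Uun; exact: (bigcup_sup (i := n.+1)).
Qed.

(** An ideal [P] maximal among those over [K] that miss [M] is prime: adjoining an outside [x] or
    [y] creates elements of [M], whose product would fall into [P] if [x * y] did. *)
Lemma exists_prime_avoiding K (M : set A) : is_ideal K -> mult_closed M ->
  (forall x, M x -> ~ K x) ->
  exists P, [/\ is_prime_ideal P, K `<=` P & forall x, M x -> ~ P x].
Proof.
move=> iK [M1 MM] MK.
have [||P [iP KP MP] Pmax] := noetherian_max
    [set J | [/\ is_ideal J, K `<=` J & forall x, M x -> ~ J x]].
- by move=> J [].
- by exists K; split.
exists P; split=> //; split; first by split=> //; exact: MP.
have hit x : ~ P x -> exists a r, P a /\ M (a + r * x).
  move=> nPx; apply: contrapT => no; apply: nPx.
  rewrite -(Pmax (ideal_adjoin P x)) //;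
    [exact: ideal_adjoin_mem| |exact: sub_ideal_adjoin].
  split; first exact: ideal_adjoin_ideal.
    by apply: (subset_trans KP); exact: sub_ideal_adjoin.
  by move=> z Mz [a Pa [r zE]]; apply: no; exists a, r; rewrite -zE.
move=> x y Pxy; apply: contrapT => /not_orP[/hit[a [r [Pa Max]]] /hit[b [s [Pb Mby]]]].
apply: (MP _ (MM _ _ Max Mby)).
have -> : (a + r * x) * (b + s * y) = (b + s * y) * a + (r * x) * b + r * s * (x * y) by ring.
by do 2?apply: idealD => //; exact: idealMl.
Qed.

(** Noetherian induction. A maximal counterexample is neither the whole ring nor prime, so it
    contains some [x * y] but neither factor; a prime over it contains [x] or [y], and the lists for
    the two larger ideals can be concatenated. *)
Lemma finitely_many_primes I : is_ideal I ->
  exists l : seq (set A), (forall P, P \in l -> is_prime_ideal P) /\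
    forall Q, is_prime_ideal Q -> I `<=` Q -> exists2 P, P \in l & P `<=` Q.
Proof.
move=> iI; apply: contrapT => noI.
have [||M [iM noM] Mmax] := noetherian_max
    [set J | is_ideal J /\ ~ exists l : seq (set A),
      (forall P, P \in l -> is_prime_ideal P) /\
      forall Q, is_prime_ideal Q -> J `<=` Q -> exists2 P, P \in l & P `<=` Q].
- by move=> J [].
- by exists I; split.
have adj x : ~ M x -> exists l : seq (set A),
    (forall P, P \in l -> is_prime_ideal P) /\
    forall Q, is_prime_ideal Q -> M `<=` Q -> Q x -> exists2 P, P \in l & P `<=` Q.
  move=> nMx; apply: contrapT => no; apply: nMx.
  rewrite -(Mmax (ideal_adjoin M x));
    [exact: ideal_adjoin_mem| |exact: sub_ideal_adjoin].
  split; first exact: ideal_adjoin_ideal.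
  move=> [l [lP lQ]]; apply: no; exists l; split=> // Q pQ MQ Qx.
  by apply: lQ => //; apply: ideal_adjoin_sub => //; exact: prime_ideal.
apply: noM.
have [M1|nM1] := pselect (M 1).
  by exists [::]; split=> // Q /prime1 Q1 /(_ _ M1).
have [pM|npM] := pselect (is_prime_ideal M).
  by exists [:: M]; split=> [P|Q _ MQ]; [rewrite inE => /eqP ->|exists M; rewrite ?mem_head].
have [x [y [Mxy nMx nMy]]] : exists x y, [/\ M (x * y), ~ M x & ~ M y].
  apply: contrapT => no; apply: npM; split=> // x y Mxy.
  by apply: contrapT => /not_orP[nx ny]; apply: no; exists x, y.
have [l [lP lQ]] := adj _ nMx; have [l' [lP' lQ']] := adj _ nMy.
exists (l ++ l'); split=> [P|Q pQ MQ].
  by rewrite mem_cat => /orP[/lP|/lP'].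
by case: (primeM pQ _ _ (MQ _ Mxy)) => [/(lQ Q pQ MQ)|/(lQ' Q pQ MQ)] [P Pl PQ];
  exists P => //; rewrite mem_cat Pl ?orbT.
Qed.

Lemma minimal_prime_below Q : is_prime_ideal Q ->
  exists2 P, is_minimal_prime P & P `<=` Q.
Proof.
move=> pQ; have [l [lP lQ]] := finitely_many_primes [set 0] ideal_zero.
have Q0 P : is_prime_ideal P -> [set 0] `<=` P.
  by move=> pP x ->; exact/ideal0/prime_ideal.
have [P [Pl PQ Pmin]] := seq_minimal_below l _ (lQ _ pQ (Q0 _ pQ)).
exists P => //; split=> [|P' pP' P'P]; first exact: lP.
have [P'' P''l P''P'] := lQ _ pP' (Q0 _ pP').
apply/seteqP; split=> //.
by rewrite -(Pmin _ P''l) //; exact: subset_trans P'P.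
Qed.

Lemma finitely_many_minimal_primes :
  exists l : seq (set A), forall P, is_minimal_prime P -> P \in l.
Proof.
have [l [lP lQ]] := finitely_many_primes [set 0] ideal_zero.
exists l => P [pP Pmin]; have [|P' P'l P'P] := lQ _ pP.
  by move=> x ->; exact/ideal0/prime_ideal.
by rewrite -(Pmin P') //; exact: lP.
Qed.

(** [t] is a product of elements outside [P], one from each of the finitely many other minimal
    primes. *)
Lemma minimal_prime_separator P : is_minimal_prime P ->
  exists2 t, ~ P t & forall P', is_minimal_prime P' -> P' <> P -> P' t.
Proof.
move=> mP; have [l lP] := finitely_many_minimal_primes.
suff [t Pt tP] : exists2 t, ~ P t &
    forall P', P' \in l -> is_minimal_prime P' -> P' <> P -> P' t.
  by exists t => // P' mP'; apply: tP => //; exact: lP.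
elim: l {lP} => [|P0 l [t Pt tP]]; first by exists 1 => //; case: mP => /prime1.
have [[mP0 P0P]|no] := pselect (is_minimal_prime P0 /\ P0 <> P); last first.
  exists t => // P'; rewrite inE => /predU1P[->|]; last exact: tP.
  by move=> mP0 P0P; case: no.
have [e P0e Pe] : exists2 e, P0 e & ~ P e.
  apply: contrapT => no; apply: P0P; apply: (proj2 mP); first by case: mP0.
  by move=> e P0e; apply: contrapT => Pe; apply: no; exists e.
exists (e * t); first by case: mP => pP _ /(primeM pP)[].
move=> P'; rewrite inE => /predU1P[-> _ _|P'l mP' P'P].
  by apply: idealMr => //; case: mP0 => /prime_ideal.
by apply: idealMl; [case: mP' => /prime_ideal|exact: tP].
Qed.

(* Adding [t] moves [d] out of every minimal prime, while [t] vanishes at the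
   minimal primes that already miss [d]. *)
Lemma minimal_prime_adjust d : exists t, forall P, is_minimal_prime P ->
  (P d /\ ~ P t) \/ (~ P d /\ P t).
Proof.
have [l lP] := finitely_many_minimal_primes.
(* Each round of the induction settles one more prime and leaves [t] in those still to come; without
   repetitions, no settled prime is met again. *)
suff [t tP] : exists t, forall P, is_minimal_prime P ->
    if P \in undup l then P d <-> ~ P t else P t.
  exists t => P mP; have := tP P mP; rewrite mem_undup lP // => -[dt td].
  have [Pd|Pd] := pselect (P d); [left|right]; split=> //; first exact: dt.
  by apply: contrapT => /td.
elim: (undup l) (undup_uniq l) => [_|P0 r IH /= /andP[P0r /IH[t tP]]].
  by exists 0 => P [/prime_ideal/ideal0].
have [[mP0 P0d]|no] := pselect (is_minimal_prime P0 /\ P0 d); last first.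
  exists t => P mP; have := tP P mP; rewrite inE.
  have [PE|//] /= := eqVneq P P0; rewrite -PE in P0r no *.
  by rewrite (negbTE P0r) => Pt; split=> // Pd; case: no.
have [e P0e eP] := minimal_prime_separator P0 mP0.
exists (e + t) => P mP; have := tP P mP; rewrite inE.
have iP : is_ideal P by case: mP => /prime_ideal.
have [->|/eqP PP0] /= := eqVneq.
  rewrite (negbTE P0r) => P0t; split=> // _ P0et; apply: P0e.
  have iP0 : is_ideal P0 by case: mP0 => /prime_ideal.
  by rewrite -(addrK t e) -mulN1r; apply: idealD => //; exact: idealMl.
have Pe : P e by exact: eP.
have -> : P (e + t) = P t; last by [].
apply/propext; split=> [Pet|Pt]; last exact: idealD.
by rewrite -(addKr e t) -mulN1r; apply: idealD => //; exact: idealMl.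
Qed.

End Noetherian.

(** * Frobenius powers and tight closure *)

Section FrobeniusPowers.
Context {A : comPzRingType} {p : nat} (p_prime : prime p) (pA0 : p%:R = 0 :> A).
Implicit Types (I J b : set A) (x y c : A).

(** The characteristic enters as [p%:R = 0], which passes from [R] to [S^-1 R] even if the latter is
    zero. *)
Lemma frobD n x y : (x + y) ^+ (p ^ n)%N = x ^+ (p ^ n)%N + y ^+ (p ^ n)%N.
Proof.
elim: n x y => [|n IH] x y; first by rewrite !expr1.
rewrite expnS !exprM; set P := (p ^ n)%N in IH *; rewrite -IH; congr (_ ^+ P).
have [q pE] : exists q, p = q.+1 by case: p p_prime => // q; exists q.
rewrite exprDn pE big_ord_recl big_ord_recr /= -pE.
have -> : bump 0 q = p by rewrite pE.
rewrite subn0 subnn bin0 binn !expr0 mulr1 mul1r big1 ?add0r // => i _.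
have : (p %| 'C(p, bump 0 i))%N.
  by apply: prime_dvd_bin => //; rewrite /bump leq0n add1n /= pE ltnS ltn_ord.
by case/dvdnP=> m ->; rewrite -mulr_natr natrM pA0 !mulr0.
Qed.

Lemma expn_frob_gt0 n : (0 < p ^ n)%N.
Proof. by rewrite expn_gt0 prime_gt0. Qed.

Lemma frob_preim_ideal J n : is_ideal J -> is_ideal [set x | J (x ^+ (p ^ n)%N)].
Proof.
move=> iJ; split=> [|x y Jx Jy|c x Jx] /=.
- by rewrite expr0n gtn_eqF ?expn_frob_gt0 //; exact: ideal0.
- by rewrite frobD; exact: idealD.
- by rewrite exprMn; exact: idealMl.
Qed.

Lemma frob_powX b n x : b x -> frob_pow p n b (x ^+ (p ^ n)%N).
Proof. by move=> bx; apply: sub_ideal_gen; exists x. Qed.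

Lemma frob_pow_ideal b n : is_ideal (frob_pow p n b).
Proof. exact: ideal_gen_ideal. Qed.

Lemma frob_pow_sub b J n : is_ideal J ->
  (forall x, b x -> J (x ^+ (p ^ n)%N)) -> frob_pow p n b `<=` J.
Proof. by move=> iJ bJ; apply: ideal_gen_sub => // _ [x bx <-]; exact: bJ. Qed.

Lemma frob_pow_comp b m n : frob_pow p m (frob_pow p n b) = frob_pow p (n + m) b.
Proof.
apply/seteqP; split.
  apply: frob_pow_sub; first exact: frob_pow_ideal.
  apply: frob_pow_sub; first exact/frob_preim_ideal/frob_pow_ideal.
  by move=> x bx /=; rewrite -exprM -expnD; exact: frob_powX.
apply: frob_pow_sub; first exact: frob_pow_ideal.
by move=> x bx; rewrite expnD exprM; do 2!apply: frob_powX.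
Qed.

Lemma frob_pow0 b : is_ideal b -> frob_pow p 0 b = b.
Proof.
move=> ib; apply/seteqP; split; last by move=> x bx; rewrite -[x]expr1; exact: frob_powX.
by apply: frob_pow_sub => // x; rewrite expr1.
Qed.

(* Krull's intersection theorem for Frobenius powers: take [K] maximal with
   [K `&` (c) = b c]; then [K] contains a power of every element of [b]. *)
Lemma frob_krull (noethA : noetherian A) b c N : is_ideal b ->
  (forall n, (N <= n)%N -> frob_pow p n b c) -> exists2 u, b u & c = u * c.
Proof.
move=> ib bc.
pose C : set A := [set z | exists r, z = r * c].
pose bC : set A := [set z | exists2 u, b u & z = u * c].
have iC : is_ideal bC.
  split=> [|_ _ [u bu ->] [v bv ->]|r _ [u bu ->]].
  - by exists 0; [exact: ideal0|rewrite mul0r].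
  - by exists (u + v); [exact: idealD|ring].
  - by exists (r * u); [exact: idealMl|ring].
have [||K [iK KC] Kmax] := noetherian_max noethA [set K | is_ideal K /\ K `&` C = bC].
- by move=> K [].
- exists bC; split=> //; apply/seteqP; split=> [z []//|z bCz]; split=> //.
  by case: bCz => u _ ->; exists u.
have bCK : bC `<=` K by rewrite -KC => z [].
(* The colon ideals of [K] by [a ^+ m] stabilize. For such an [m], adjoining [a ^+ m] to [K] leaves
   the intersection with [C] unchanged, so maximality puts [a ^+ m] into [K]. *)
have pow a : b a -> exists m, K (a ^+ m).
  move=> ba.
  have [||_ [m ->] mmax] := noetherian_max noethA
      [set J | exists m, J = [set y | K (a ^+ m * y)]].
  - by move=> _ [m ->]; exact: ideal_colon.
  - by exists [set y | K (a ^+ 0 * y)], 0%N.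
  exists m.
  suff <- : ideal_adjoin K (a ^+ m) = K by exact: ideal_adjoin_mem.
  apply: Kmax; last exact: sub_ideal_adjoin.
  split; first exact: ideal_adjoin_ideal.
  apply/seteqP; split; last by rewrite -KC => z [Kz Cz]; split=> //; exact: sub_ideal_adjoin.
  move=> y [[k Kk [r yE]] [s ysc]].
  have Kra : K (a ^+ m.+1 * r).
    have -> : a ^+ m.+1 * r = a * y - a * k by rewrite yE exprS; ring.
    apply: idealD => //; last by rewrite -mulNr; exact: idealMl.
    by apply: bCK; exists (a * s); [exact: idealMr|rewrite ysc mulrA].
  have : [set y | K (a ^+ m.+1 * y)] r by [].
  rewrite (mmax [set y | K (a ^+ m.+1 * y)]); last 2 first.
  - by exists m.+1.
  - by move=> z /= Kz; rewrite exprS -mulrA; exact: idealMl.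
  move=> /= Kr; rewrite -KC; split; last by exists s.
  by rewrite yE [r * _]mulrC; exact: idealD.
have [n Nn bK] : exists2 n, (N <= n)%N & forall x, b x -> K (x ^+ (p ^ n)%N).
  have [s bE] := noethA _ ib.
  suff [n Nn sK] : exists2 n, (N <= n)%N & forall x, x \in s -> K (x ^+ (p ^ n)%N).
    by exists n => //; rewrite bE; apply: ideal_gen_sub => //; exact: frob_preim_ideal.
  have : [set` s] `<=` b by rewrite bE; exact: sub_ideal_gen.
  elim: s {bE} => [|x s IH] sb; first by exists N.
  have [|n Nn sK] := IH; first by move=> y /= ys; apply: sb; rewrite /= inE ys orbT.
  have [m Km] := pow _ (sb x (mem_head _ _)).
  exists (n + m)%N => [|y]; first exact: leq_trans (leq_addr _ _).
  rewrite inE => /predU1P[->|/sK Ky]; last first.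
    by apply: (idealX iK) Ky; rewrite leq_pexp2l ?prime_gt0 ?leq_addr.
  apply: (idealX iK) Km; apply: leq_trans (leq_addl n m) _.
  by rewrite ltnW // ltn_expl // prime_gt1.
have Kc : K c by apply: (frob_pow_sub b K n iK bK); exact: bc.
have : bC c by rewrite -KC; split=> //; exists 1; rewrite mul1r.
by [].
Qed.

Lemma off_minimal_primes1 : off_minimal_primes A 1.
Proof. by move=> P [/prime1]. Qed.

Lemma off_minimal_primesM c d : off_minimal_primes A c -> off_minimal_primes A d ->
  off_minimal_primes A (c * d).
Proof. by move=> oc od P mP; case: (mP) => pP _ /(primeM pP)[/oc|/od]; apply. Qed.

Lemma off_minimal_primesX c n : off_minimal_primes A c -> off_minimal_primes A (c ^+ n).
Proof. by move=> oc P mP; case: (mP) => pP _ /(primeX pP)/oc; apply. Qed.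

Lemma tight_closure_ideal b : is_ideal (tight_closure p b).
Proof.
split=> [|x y [c oc [m cx]] [d od [n dy]]|r x [c oc [N cx]]].
- exists 1; first exact: off_minimal_primes1.
  exists 0%N => n _; rewrite mul1r expr0n gtn_eqF ?expn_frob_gt0 //.
  exact/ideal0/frob_pow_ideal.
- exists (c * d); first exact: off_minimal_primesM.
  exists (m + n)%N => k mnk; rewrite frobD mulrDr.
  have iF := frob_pow_ideal b k.
  apply: (idealD iF); first rewrite mulrAC; last rewrite -mulrA.
    apply: (idealMr iF); apply: cx; exact: leq_trans (leq_addr _ _) mnk.
  apply: (idealMl iF); apply: dy; exact: leq_trans (leq_addl _ _) mnk.
- exists c => //; exists N => n Nn; rewrite exprMn mulrCA.
  by apply: (idealMl (frob_pow_ideal b n)); exact: cx.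
Qed.

(** If [1] were in the closure, [c] would lie in almost all Frobenius powers of [b], hence
    [c = u * c] with [u] in [b]. A minimal prime below a prime over [b] contains [(1 - u) * c] but
    not [c], so it contains [1 - u]; with [u] this puts [1] into the larger prime. *)
Lemma tight_closure_proper (noethA : noetherian A) b :
  is_proper_ideal b -> ~ tight_closure p b 1.
Proof.
move=> [ib b1] [c oc [N bN]].
have [|u bu cE] := frob_krull noethA b c N ib.
  by move=> n /bN; rewrite expr1n mulr1.
have [|x ->//|P [pP bP _]] := exists_prime_avoiding noethA b [set 1] ib.
  by split=> // x y -> ->; rewrite /= mulr1.
have [P' mP' P'P] := minimal_prime_below noethA P pP; have [pP' _] := mP'.
have : P' ((1 - u) * c) by rewrite mulrBl mul1r -cE subrr; exact/ideal0/prime_ideal.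
case/(primeM pP')=> [/P'P P1u|/oc]; last exact.
by apply: (prime1 pP); rewrite -(subrK u 1); apply: (idealD (prime_ideal pP)) => //; exact: bP.
Qed.

End FrobeniusPowers.

(** * Primary decompositions, associated primes and products in radicals *)

Section PrimaryDecompositions.
Context {A : comPzRingType}.
Implicit Types (I J P Q q : set A) (x y z : A).

(* Unlike primary ideals, these are stable under preimages and colons. *)
Definition primary_or_whole q : Prop :=
  is_ideal q /\ forall x y, q (x * y) -> q x \/ radical q y.

Lemma primary_or_wholeP q : is_primary_ideal q <-> primary_or_whole q /\ ~ q 1.
Proof. by split=> [[[iq q1] pq]|[[iq pq] q1]]. Qed.

Lemma primary_or_wholeN q x : primary_or_whole q -> ~ q x -> is_primary_ideal q.
Proof.
move=> pq qx; apply/primary_or_wholeP; split=> // q1; apply: qx.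
by rewrite -[x]mulr1; case: pq => iq _; exact: idealMl.
Qed.

Lemma radical_prime q : is_primary_ideal q -> is_prime_ideal (radical q).
Proof.
move=> [[iq q1] pq]; split; first by split; [exact: radical_ideal|case=> m; rewrite expr1n].
move=> x y [m]; rewrite exprMn => /pq[xm|ym]; first by left; exists m.
by right; rewrite -radical_idem; exists m.
Qed.

Lemma primary_or_whole_setI I J : primary_or_whole I -> primary_or_whole J ->
  radical I = radical J -> primary_or_whole (I `&` J).
Proof.
move=> [iI pI] [iJ pJ] IJ; split; first exact: ideal_setI.
move=> x y [Ixy Jxy]; rewrite radicalI // -IJ setIid.
have [Iy|Iy] := pselect (radical I y); [by right|left].
by split; [case/pI: Ixy|case/pJ: Jxy; rewrite -?IJ].
Qed.

(** [C] is an arbitrary set because all the roots of a test element are to be used at once. *)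
Lemma primary_or_whole_colon q (C : set A) : primary_or_whole q ->
  primary_or_whole [set y | forall c, C c -> q (c * y)].
Proof.
move=> [iq pq]; split.
  split=> [c Cc|x y qx qy c Cc|r x qx c Cc]; have iqc := ideal_colon q c iq.
  - exact: (ideal0 iqc).
  - exact: (idealD iqc _ _ (qx c Cc) (qy c Cc)).
  - exact: (idealMl iqc _ _ (qx c Cc)).
move=> x y /= qxy; have [qy|qy] := pselect (radical q y).
  by right; case: qy => m qym; exists m => c _; exact: idealMl.
by left=> c /qxy; rewrite mulrA => /pq[].
Qed.

(** The witness [x] shows that some [c] in [C] is outside [q]; then [c * y ^+ m] in [q] forces
    [y ^+ m] into the radical. *)
Lemma radical_colon q (C : set A) x : primary_or_whole q ->
  ~ (forall c, C c -> q (c * x)) ->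
  radical [set y | forall c, C c -> q (c * y)] = radical q.
Proof.
move=> pq qx; have [iq qP] := pq; apply/seteqP; split=> [y [m qym]|y [m qym]].
  have [c Cc qcx] : exists2 c, C c & ~ q (c * x).
    by apply: contrapT => no; apply: qx => c Cc; apply: contrapT => ?; apply: no; exists c.
  case: (qP _ _ (qym _ Cc)) => [qc|]; first by case: qcx; exact: idealMr.
  by rewrite -{2}radical_idem; exists m.
by exists m => c _; exact: idealMl.
Qed.

Lemma minimal_family (T : Type) (G : set (set T)) (D X : set T) :
  (exists k (q : 'I_k -> set T), (forall i, G (q i)) /\ X = D `&` \bigcap_i q i) ->
  exists k (q : 'I_k -> set T), [/\ forall i, G (q i), X = D `&` \bigcap_i q i,
    forall i, ~ (D `&` \bigcap_(j in [set j | j != i]) q j `<=` q i) &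
    forall k' (q' : 'I_k' -> set T),
      (forall i, G (q' i)) -> X = D `&` \bigcap_i q' i -> (k <= k')%N].
Proof.
move=> exq.
pose has k := exists q : 'I_k -> set T, (forall i, G (q i)) /\ X = D `&` \bigcap_i q i.
have ex_has : exists k, `[< has k >].
  by have [k hk] := exq; exists k; exact/asboolP.
have [k /asboolP[q [Gq XE]] kmin] := ex_minnP ex_has.
have {}kmin k' (q' : 'I_k' -> set T) :
    (forall i, G (q' i)) -> X = D `&` \bigcap_i q' i -> (k <= k')%N.
  by move=> Gq' XE'; apply: kmin; apply/asboolP; exists q'.
exists k, q; split=> // i red.
case: k q Gq XE kmin i red => [|k] q Gq XE kmin i red; first by case: i {red}.
suff XE' : X = D `&` \bigcap_j q (lift i j).
  by have := kmin _ _ (fun j => Gq (lift i j)) XE'; rewrite ltnn.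
rewrite XE; apply/seteqP; split=> x [Dx qx]; split=> // j _; first exact: qx.
have qx' j' : j' != i -> q j' x.
  by rewrite eq_sym => /unlift_some[j'' -> _]; exact: qx.
have [->|/qx'//] := eqVneq j i.
by apply: red; split=> // j'; exact: qx'.
Qed.

(** [G] may carry more than primariness, such as a bound on exponents, as long as it survives the
    merging of components with equal radicals. *)
Lemma minimal_primary_decomposition (G : set (set A)) I :
  G `<=` primary_or_whole ->
  (forall q q', G q -> G q' -> radical q = radical q' -> G (q `&` q')) ->
  (exists k (q : 'I_k -> set A), (forall i, G (q i)) /\ I = \bigcap_i q i) ->
  exists k (q : 'I_k -> set A),
    is_minimal_primary_decomposition I q /\ forall i, G (q i).
Proof.
move=> Gpw GI exq.
have [|k [q [Gq IE irr kmin]]] := minimal_family A G setT I.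
  by case: exq => k [q [Gq IE]]; exists k, q; rewrite setTI.
rewrite setTI in IE.
exists k, q; split=> //; split.
- split=> // i; have := irr i; rewrite setTI => /existsNP[x /not_implyP[_ qx]].
  by apply: primary_or_wholeN qx; exact: Gpw.
- move=> i j rij; apply: contrapT => /eqP nij.
  case: k q Gq IE irr kmin i j rij nij => [|k] q Gq IE irr kmin i j rij nij.
    by case: i {rij nij}.
  (* [lift i] skips the index [i], whose component is merged into the one at [j]. *)
  pose q' t := if lift i t == j then q i `&` q j else q (lift i t).
  have Gq' t : G (q' t) by rewrite /q'; case: ifP => _ //; exact: GI.
  suff IE' : I = setT `&` \bigcap_t q' t by have := kmin _ _ Gq' IE'; rewrite ltnn.
  rewrite setTI IE; apply/seteqP; split=> x qx t _.
    by rewrite /q'; case: ifP => _; [split|]; exact: qx.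
  have qij : q i x /\ q j x.
    have [t' jE _] := unlift_some nij.
    by have := qx t' Logic.I; rewrite /q' -jE eqxx.
  have [->|] := eqVneq t i; first by case: qij.
  rewrite eq_sym => /unlift_some[t' tE _].
  by have := qx t' Logic.I; rewrite /q' -tE; case: eqP => [->|//] _; case: qij.
- by move=> i; have := irr i; rewrite setTI.
Qed.

(** Components equal to the whole ring disappear in a decomposition of least length, so preimages
    and colons need no check of properness. *)
Lemma has_primary_decompositionP I : has_primary_decomposition I <->
  exists k (q : 'I_k -> set A), (forall i, primary_or_whole (q i)) /\ I = \bigcap_i q i.
Proof.
split=> [[k [q [pq IE]]]|exq].
  by exists k, q; split=> // i; have /primary_or_wholeP[] := pq i.
have [//|//=|k [q [[dq _ _] _]]] := minimal_primary_decomposition primary_or_whole I _ _ exq.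
  exact: primary_or_whole_setI.
by exists k, q.
Qed.

(** Irredundance provides an [x] in every component but the [i]-th; the colon of [I] by [x] is then
    that of [q i], whose radical is the radical of [q i]. *)
Lemma ass_colon I P : ass I P ->
  is_prime_ideal P /\ exists x, P = radical [set y | I (x * y)].
Proof.
move=> [k [q [[[pq IE] _ irr] [i ->]]]]; split; first exact: radical_prime.
have /existsNP[x /not_implyP[qx qix]] := irr i; exists x.
have [[iq _] qP] := pq i.
apply/seteqP; split=> y [m]; last first.
  rewrite /= IE => /(_ i Logic.I)/qP[//|].
  by rewrite -{2}radical_idem; exists m.
move=> qym; exists m; rewrite /= IE => j _.
have [->|ji] := eqVneq j i; first exact: idealMl.
by apply: idealMr; [case: (pq j) => -[[]]|exact: qx].
Qed.

(** Were [P] none of the radicals, each [i] would have some [y i] outside [P] with [x * y i] in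
    [q i]; the product of the [y i] lies in [P], against primality. Redundant decompositions are
    allowed, such as those pulled back to [R]. *)
Lemma prime_colon_component I P k (q : 'I_k -> set A) x :
  (forall i, primary_or_whole (q i)) -> I = \bigcap_i q i ->
  is_prime_ideal P -> P = radical [set y | I (x * y)] ->
  exists i, P = radical (q i).
Proof.
move=> pq IE pP PE.
have Psub i : ~ q i x -> P `<=` radical (q i).
  rewrite PE => qx y [m]; rewrite /= IE => /(_ i Logic.I)/(proj2 (pq i))[//|].
  by rewrite -{2}radical_idem; exists m.
apply: contrapT => no.
have /choice[y yP] i : exists y, q i (x * y) /\ ~ P y.
  have [qx|qx] := pselect (q i x).
    by exists 1; rewrite mulr1; split=> //; exact: prime1.
  have /existsNP[y /not_implyP[[m qym] Py]] : ~ radical (q i) `<=` P.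
    by move=> qP; apply: no; exists i; apply/seteqP; split=> //; exact: Psub.
  exists (y ^+ m); split; last by move/(primeX pP).
  by apply: idealMl => //; case: (pq i).
have : P (\prod_i y i).
  rewrite PE; exists 1%N; rewrite expr1 /= IE => i _.
  rewrite (bigD1 i) //= mulrA; apply: idealMr; first by case: (pq i).
  by case: (yP i).
by move=> /(prime_prod _ _ _ pP)[i]; case: (yP i).
Qed.

(** First uniqueness theorem: a prime can be shown to be associated by exhibiting a colon, whatever
    the decomposition. *)
Lemma assP I P : has_primary_decomposition I ->
  (ass I P <-> is_prime_ideal P /\ exists x, P = radical [set y | I (x * y)]).
Proof.
move=> /has_primary_decompositionP exq; split=> [|[pP [x PE]]]; first exact: ass_colon.
have [//|//=|k [q [mq _]]] := minimal_primary_decomposition primary_or_whole I _ _ exq.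
  exact: primary_or_whole_setI.
have [[pq IE] _ _] := mq.
have [|i Pi] := prime_colon_component I P k q x _ IE pP PE.
  by move=> i; have /primary_or_wholeP[] := pq i.
by exists k, q; split=> //; exists i.
Qed.

Lemma ideal_pow_gen_sub (X J : set A) h : is_ideal J ->
  (forall u : seq A, size u = h -> (forall x, x \in u -> X x) -> J (\prod_(x <- u) x)) ->
  ideal_pow (ideal_gen X) h `<=` J.
Proof.
elim: h J => [|h IH] J iJ prodJ.
  have := prodJ [::] erefl; rewrite big_nil => J1 x _.
  by rewrite -[x]mulr1; apply: idealMl => //; exact: J1.
apply: ideal_gen_sub => // _ [x [y [Xx hy ->]]]; rewrite mulrC.
move: x Xx; apply: ideal_gen_sub; first exact: ideal_colon.
move=> x Xx /=; rewrite mulrC; move: y hy;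
  apply: (IH [set y | J (x * y)]); first exact: ideal_colon.
move=> u uh uX /=; have := prodJ (x :: u); rewrite big_cons; apply; first by rewrite /= uh.
by move=> z; rewrite inE => /predU1P[->|/uX].
Qed.

(** Pigeonhole: either [g] occurs at least [m] times in [u], or removing its fewer than [m]
    occurrences leaves enough factors for the rest of [s]. *)
Lemma prod_mem_of_powers (J : set A) (s : seq A) m (u : seq A) : is_ideal J ->
  (forall g, g \in s -> J (g ^+ m)) -> (forall x, x \in u -> x \in s) ->
  (size s * m < size u)%N -> J (\prod_(x <- u) x).
Proof.
move=> iJ; elim: s u => [|g s IH] u sJ us su.
  by case: u us su => [|x u] // /(_ x (mem_head _ _)).
rewrite (bigID (pred1 g)) /=.
rewrite (eq_bigr (fun=> g)) => [|x /eqP//].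
rewrite big_const_seq iter_mulr_1 -size_filter.
have [mg|gm] := leqP m (size [seq x <- u | x == g]).
  by apply: (idealMr iJ); apply: (idealX iJ _ _ _ mg); apply: sJ; exact: mem_head.
apply: (idealMl iJ); rewrite -big_filter; apply: IH.
- by move=> x xs; apply: sJ; rewrite inE xs orbT.
- by move=> x; rewrite mem_filter => /andP[xg /us]; rewrite inE (negbTE xg).
- have uE : (size [seq x <- u | x == g] + size [seq x <- u | x != g])%N = size u.
    by rewrite !size_filter; exact: (count_predC (pred1 g)).
  move: su; rewrite -uE /= mulSn.
  by move: (size s * m)%N (size [seq x <- u | x == g]) gm => t k; lia.
Qed.

(** The radical is finitely generated, so one [m] serves all generators and the pigeonhole applies.
    Lists of factors can be transported along [psi n], and allowing every length from [h] on lets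
    bounds for several ideals be added. *)
Lemma radical_nilpotent (noethA : noetherian A) J : is_ideal J ->
  exists h, forall u : seq A, (h <= size u)%N ->
    (forall x, x \in u -> radical J x) -> J (\prod_(x <- u) x).
Proof.
move=> iJ; have [s rJE] := noethA _ (radical_ideal J iJ).
have [m sJ] : exists m, forall g, g \in s -> J (g ^+ m).
  have : [set` s] `<=` radical J by rewrite rJE; exact: sub_ideal_gen.
  elim: s {rJE} => [|g s IH] sJ; first by exists 0%N.
  have [|m mJ] := IH; first by move=> y /= ys; apply: sJ; rewrite /= inE ys orbT.
  have [n Jn] := sJ g (mem_head _ _); exists (n + m)%N => x.
  rewrite inE => /predU1P[->|/mJ Jx].
    by apply: (idealX iJ) Jn; exact: leq_addr.
  by apply: (idealX iJ) Jx; exact: leq_addl.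
have pow_mem h (u : seq A) : size u = h -> (forall x, x \in u -> radical J x) ->
    ideal_pow (radical J) h (\prod_(x <- u) x).
  elim: h u => [|h IH] [|x u] //= [uh] uJ.
  rewrite big_cons; apply: sub_ideal_gen; exists x, (\prod_(x <- u) x); split=> //.
    exact/uJ/mem_head.
  by apply: IH => // y yu; apply: uJ; rewrite inE yu orbT.
exists (size s * m).+1 => u su uJ.
rewrite -(cat_take_drop (size s * m).+1 u) big_cat /=; apply: (idealMr iJ).
have : ideal_pow (radical J) (size s * m).+1 (\prod_(x <- take (size s * m).+1 u) x).
  apply: pow_mem; first by rewrite size_takel.
  by move=> x /mem_take /uJ.
rewrite rJE; apply: ideal_pow_gen_sub => // v vs vX.
by apply: (prod_mem_of_powers J s m) => //; rewrite vs.
Qed.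

End PrimaryDecompositions.

(** * Preimages under ring homomorphisms *)

Lemma ideal_preimage {A B : comPzRingType} (f : {rmorphism A -> B}) (J : set B) :
  is_ideal J -> is_ideal (f @^-1` J).
Proof.
move=> iJ; split=> [|x y fx fy|c x fx] /=.
- by rewrite rmorph0; exact: ideal0.
- by rewrite rmorphD; exact: idealD.
- by rewrite rmorphM; exact: idealMl.
Qed.

Lemma primary_or_whole_preimage {A B : comPzRingType} (f : {rmorphism A -> B}) (q : set B) :
  primary_or_whole q -> primary_or_whole (f @^-1` q).
Proof.
move=> [iq pq]; split; first exact: ideal_preimage.
move=> x y /=; rewrite rmorphM => /pq[|[m fy]]; first by left.
by right; exists m; rewrite /= rmorphXn.
Qed.

Lemma radical_preimage {A B : comPzRingType} (f : {rmorphism A -> B}) (q : set B) :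
  radical (f @^-1` q) = f @^-1` radical q.
Proof.
by apply/seteqP; split=> x [m]; rewrite /= => qx; exists m;
  move: qx; rewrite /= rmorphXn.
Qed.

Lemma prime_preimage {A B : comPzRingType} (f : {rmorphism A -> B}) (P : set B) :
  is_prime_ideal P -> is_prime_ideal (f @^-1` P).
Proof.
move=> [[iP P1] PM]; split; first split; first exact: ideal_preimage.
  by rewrite /= rmorph1.
by move=> x y /=; rewrite rmorphM; exact: PM.
Qed.

(** * The homomorphisms [psi n] into a perfect ring, and linear growth *)

Section PerfectClosure.
Context {p : nat} {R Rinf : comNzRingType} {psi0 : {rmorphism R -> Rinf}}.
Hypothesis perfRinf : is_perfect p Rinf.
Implicit Types (r c : R) (I J P Q : set Rinf) (a : nat -> set R).

Local Notation psi := (psi p psi0).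

Let p_prime : prime p. Proof. by case: perfRinf => /pcharf_prime. Qed.

Let pRinf0 : p%:R = 0 :> Rinf. Proof. by case: perfRinf => /pcharf0. Qed.

(** Surjectivity of Frobenius makes the set in [psi] nonempty, so the default value never occurs. *)
Lemma psiX n r : psi n r ^+ (p ^ n)%N = psi0 r.
Proof.
suff : exists y : Rinf, y ^+ (p ^ n)%N = psi0 r by exact: xgetPex.
elim: n (psi0 r) => [|n IH] x; first by exists x; rewrite expr1.
case: perfRinf => _ [root _ rootK]; have [y <-] := IH x.
by exists (root y); rewrite expnS exprM; congr (_ ^+ _); exact: rootK.
Qed.

Lemma perfect_exp_inj n : injective (fun x : Rinf => x ^+ (p ^ n)%N).
Proof.
elim: n => [|n IH] x y; first by rewrite !expr1.
rewrite /= !expnS !exprM => /IH; case: perfRinf => _ [root frobK _] xy.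
by rewrite -(frobK x) -(frobK y); congr root.
Qed.

(** Identities are checked after raising to the power [p ^ n], which is injective. The morphism is
    given by an existential because it depends on the perfection of [Rinf]. *)
Lemma psi_rmorphism n : exists g : {rmorphism R -> Rinf}, g = psi n :> (R -> Rinf).
Proof.
have psiB : {morph psi n : x y / x - y}.
  move=> x y; apply: (perfect_exp_inj n); rewrite /= psiX.
  apply: (addIr (psi n y ^+ (p ^ n)%N)).
  by rewrite -(frobD p_prime pRinf0) subrK !psiX -rmorphD subrK.
have psi1M : (psi n 1 = 1) * {morph psi n : x y / x * y}.
  split=> [|x y]; apply: (perfect_exp_inj n); rewrite /=.
    by rewrite psiX rmorph1 expr1n.
  by rewrite exprMn !psiX rmorphM.
pose fB := GRing.isZmodMorphism.Build R Rinf (psi n) psiB.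
pose fM := GRing.isMonoidMorphism.Build R Rinf (psi n) psi1M.
by exists (HB.pack_for {rmorphism R -> Rinf} (psi n) fB fM).
Qed.

Lemma psiM n : {morph psi n : x y / x * y}.
Proof. by have [g <-] := psi_rmorphism n; exact: rmorphM. Qed.

Lemma psi1 n : psi n 1 = 1.
Proof. by have [g <-] := psi_rmorphism n; exact: rmorph1. Qed.

Lemma psi_prod n (u : seq R) : psi n (\prod_(x <- u) x) = \prod_(x <- u) psi n x.
Proof. by have [g <-] := psi_rmorphism n; exact: rmorph_prod. Qed.

Lemma psi_frob m n r : psi (m + n) (r ^+ (p ^ n)%N) = psi m r.
Proof.
apply: (perfect_exp_inj (m + n)); rewrite /= psiX rmorphXn -(psiX m).
by rewrite -exprM -expnD.
Qed.

Lemma psi_addnX m n r : psi (m + n) r ^+ (p ^ n)%N = psi m r.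
Proof. by have [g gE] := psi_rmorphism (m + n); rewrite -gE -rmorphXn gE psi_frob. Qed.

Lemma psi_exp n r : psi n (r ^+ (p ^ n)%N) = psi0 r.
Proof. by rewrite -[n in LHS]add0n psi_frob -(psiX 0) expr1. Qed.

(** A prime does not distinguish an element from its positive powers. Hence the pullbacks of a
    primary ideal along all [psi n] share one radical. *)
Lemma psi_preimage_prime n P : is_prime_ideal P -> psi n @^-1` P = psi0 @^-1` P.
Proof.
move=> pP; apply/seteqP; split=> r /=; rewrite -(psiX n) primeXE //;
  by rewrite expn_gt0 prime_gt0.
Qed.

Lemma psi_preimage_ideal n J : is_ideal J -> is_ideal (psi n @^-1` J).
Proof. by have [g <-] := psi_rmorphism n; exact: ideal_preimage. Qed.

Lemma psi_preimage_primary n Q : primary_or_whole Q -> primary_or_whole (psi n @^-1` Q).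
Proof. by have [g <-] := psi_rmorphism n; exact: primary_or_whole_preimage. Qed.

Lemma psi_preimage_radical n Q : radical (psi n @^-1` Q) = psi n @^-1` radical Q.
Proof. by have [g <-] := psi_rmorphism n; exact: radical_preimage. Qed.

Lemma corresponds_f_sequence I a : corresponds p psi0 I a -> f_sequence p a.
Proof.
move=> [iI aE]; split=> [n|n]; rewrite -!aE; first exact: psi_preimage_ideal.
apply/seteqP; split=> r; rewrite /= /frobenius -addn1 -{1}[r]expr1;
  by rewrite -{1}(expn1 p) psi_frob.
Qed.

Lemma corresponds_proper I a : corresponds p psi0 I a -> ~ a 0%N 1 ->
  forall n, is_proper_ideal (a n).
Proof.
move=> Ia a01 n; have [ia _] := corresponds_f_sequence I a Ia; split=> // an1.
by apply: a01; move: an1; case: Ia => _ aE; rewrite -!aE /= !psi1.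
Qed.

Lemma linear_growth_of_decomposition (noethR : noetherian R) I a :
  corresponds p psi0 I a -> has_primary_decomposition I -> ~ a 0%N 1 ->
  linear_growth p a.
Proof.
move=> Ia /has_primary_decompositionP[k [Q [pQ IE]]] a01.
split; [exact: corresponds_f_sequence Ia|exact: corresponds_proper Ia a01|].
have [iI aE] := Ia.
have /choice[h hP] i := radical_nilpotent noethR _ (ideal_preimage psi0 _ (proj1 (pQ i))).
(* The sum dominates every [h i], and the successor keeps the exponent positive. *)
exists (\sum_i h i).+1 => // n.
have [|||l [q [mq qP]]] := minimal_primary_decomposition
  (fun q => primary_or_whole q /\
    ideal_pow (frob_pow p n (radical q)) (\sum_i h i).+1 `<=` q) (a n).
- by move=> q [].
- move=> q q' [pq hq] [pq' hq'] qq'; split; first exact: primary_or_whole_setI.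
  rewrite radicalI; [|by case: pq|by case: pq'].
  rewrite qq' setIid => x hx; split; [apply: hq|apply: hq'] => //.
  by rewrite qq'.
- exists k, (fun i => psi n @^-1` Q i); split; last by rewrite -aE IE preimage_bigcap.
  move=> i; split; first exact: psi_preimage_primary.
  apply: ideal_pow_gen_sub; first exact: psi_preimage_ideal (proj1 (pQ i)).
  move=> u su uX.
  (* [f] recovers the elements whose powers are the generators in [u]; its value outside [u] is
     arbitrary. *)
  have /choice[f fP] x : exists y, x \in u ->
      radical (psi0 @^-1` Q i) y /\ y ^+ (p ^ n)%N = x.
    have [xu|] := boolP (x \in u); last by exists 0.
    have [y ry yx] := uX x xu; exists y => _; split=> //.
    move: ry; rewrite psi_preimage_radical radical_preimage => ry.
    have [Q1|Q1] := pselect (Q i 1).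
      by exists 0%N; rewrite expr0.
    rewrite -(psi_preimage_prime n) //.
    by apply: radical_prime; exact/primary_or_wholeP.
  have := hP i [seq f x | x <- u].
  rewrite size_map su big_map /= rmorph_prod psi_prod => hi.
  (* Level [n] becomes level [0], where the bound [h i] does not depend on [n]. *)
  have -> : \prod_(x <- u) psi n x = \prod_(x <- u) psi0 (f x).
    by apply: eq_big_seq => x /fP[_ {1}<-]; exact: psi_exp.
  apply: hi; first by rewrite leqW // (bigD1 i) //= leq_addr.
  by move=> _ /mapP[x xu ->]; case: (fP x xu).
exists l, q; split=> // i; by case: (qP i).
Qed.

(** The right-hand side is independent of [n], so only finitely many primes arise. A component equal
    to the whole ring is excluded since [P] is proper. *)
Lemma ass_psi_preimage k (Q : 'I_k -> set Rinf) n (b P : set R) :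
  (forall i, primary_or_whole (Q i)) -> b = \bigcap_i (psi n @^-1` Q i) ->
  ass b P -> exists2 i, is_prime_ideal (radical (Q i)) & P = psi0 @^-1` radical (Q i).
Proof.
move=> pQ bE /ass_colon[pP [x PE]].
have [//|i Pi] := prime_colon_component b P k (fun i => psi n @^-1` Q i) x _ bE pP PE.
  by move=> i; exact: psi_preimage_primary.
have pr : is_prime_ideal (radical (Q i)).
  apply: radical_prime; apply/primary_or_wholeP; split=> // Q1.
  by apply: (prime1 pP); rewrite Pi; apply: sub_radical; rewrite /= psi1.
by exists i => //; rewrite Pi psi_preimage_radical psi_preimage_prime.
Qed.

End PerfectClosure.

(** * Localization: ideals of fractions, minimal primes, and the easy inclusion of tight closures *)

Section Localization.
Context {R L : comPzRingType} {S : set R} {phi : {rmorphism R -> L}}.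
Hypotheses (multS : mult_closed S) (locL : is_localization S phi).
Implicit Types (b P : set R) (r s t : R) (x y : L).

Definition fractions b : set L :=
  [set x | exists r s, [/\ b r, S s & x * phi s = phi r]].

Lemma denominator_prod (I : Type) (u : seq I) (F : I -> R) :
  (forall i, S (F i)) -> S (\prod_(i <- u) F i).
Proof. by case: multS => S1 SM SF; apply: big_ind. Qed.

Lemma denominatorX s n : S s -> S (s ^+ n).
Proof.
by case: multS => S1 SM Ss; elim: n => // n IH; rewrite exprS; exact: SM.
Qed.

Lemma localizationK x y s : S s -> x * phi s = y * phi s -> x = y.
Proof.
case: locL => unitS _ _ /unitS[t st] xy.
by rewrite -[x]mulr1 -[y]mulr1 -st !mulrA xy.
Qed.

Lemma fractions_ideal b : is_ideal b -> is_ideal (fractions b).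
Proof.
move=> ib; have [S1 SM] := multS; have [_ frac _] := locL.
split=> [|x y [r [s [br Ss xE]]] [r' [s' [br' Ss' yE]]]|c x [r [s [br Ss xE]]]].
- by exists 0, 1; split=> //; [exact: ideal0|rewrite mul0r rmorph0].
- exists (s' * r + s * r'), (s * s'); split; last first.
    by rewrite rmorphD !rmorphM -xE -yE; ring.
  - exact: SM.
  - by apply: idealD => //; exact: idealMl.
- have [u [t [St cE]]] := frac c.
  exists (u * r), (t * s); split; [exact: idealMl|exact: SM|].
  by rewrite !rmorphM -xE -cE; ring.
Qed.

Lemma sub_fractions b r : b r -> fractions b (phi r).
Proof. by move=> br; exists r, 1; split=> //; [case: multS|rewrite rmorph1 mulr1]. Qed.

Lemma ideal_extensionE b : is_ideal b -> ideal_extension phi b = fractions b.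
Proof.
move=> ib; apply/seteqP; split.
  apply: ideal_gen_sub; first exact: fractions_ideal.
  by move=> _ [r br <-]; exact: sub_fractions.
move=> x [r [s [br Ss xE]]]; have [unitS _ _] := locL; have [t st] := unitS s Ss.
rewrite -[x]mulr1 -st mulrA xE; apply: (idealMr (ideal_gen_ideal _)).
by apply: sub_ideal_gen; exists r.
Qed.

Lemma fractions_contract b r : is_ideal b -> fractions b (phi r) ->
  exists2 s, S s & b (s * r).
Proof.
move=> ib [r' [s [br' Ss]]]; rewrite -rmorphM; have [_ _ eqphi] := locL.
move=> /eqphi[u Su urs]; exists (u * s); first by case: multS => _; apply.
by rewrite -mulrA [s * r]mulrC urs; exact: idealMl.
Qed.

Lemma fractions_contract_prime P r : is_prime_ideal P -> (forall s, S s -> ~ P s) ->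
  fractions P (phi r) -> P r.
Proof.
move=> pP PS /(fractions_contract P r (prime_ideal pP))[s Ss].
by case/(primeM pP) => // /(PS s Ss).
Qed.

Lemma fractions_prime P : is_prime_ideal P -> (forall s, S s -> ~ P s) ->
  is_prime_ideal (fractions P).
Proof.
move=> pP PS; have iP := prime_ideal pP; have iF := fractions_ideal P iP.
split; first split=> //.
  by rewrite -(rmorph1 phi) => /(fractions_contract_prime _ _ pP PS)/(prime1 pP).
move=> x y Fxy; have [_ frac _] := locL.
have [r [s [Ss xE]]] := frac x; have [r' [s' [Ss' yE]]] := frac y.
have : fractions P (phi (r * r')).
  have -> : phi (r * r') = x * y * phi (s * s') by rewrite !rmorphM -xE -yE; ring.
  exact: idealMr.
by move=> /(fractions_contract_prime _ _ pP PS)/(primeM pP)[Pr|Pr];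
  [left; exists r, s|right; exists r', s'].
Qed.

Lemma prime_contract_disjoint (P : set L) s : is_prime_ideal P -> S s -> ~ P (phi s).
Proof.
move=> pP Ss Ps; have [unitS _ _] := locL; have [t st] := unitS s Ss.
by apply: (prime1 pP); rewrite -st; apply: idealMr => //; exact: prime_ideal.
Qed.

Lemma fractions_minimal_prime P : is_minimal_prime P -> (forall s, S s -> ~ P s) ->
  is_minimal_prime (fractions P).
Proof.
move=> [pP Pmin] PS; split=> [|P' pP' P'P]; first exact: fractions_prime.
have P'E : phi @^-1` P' = P.
  apply: Pmin; first exact: prime_preimage.
  by move=> r /P'P; exact: fractions_contract_prime.
apply/seteqP; split=> // x [r [s [Pr Ss xE]]].
have : P' (x * phi s) by rewrite xE; rewrite -P'E in Pr.
by case/(primeM pP') => // /(prime_contract_disjoint _ _ pP' Ss).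
Qed.

(** A minimal prime of [L] equals [fractions P'] for a minimal prime [P'] of [R], found below its
    contraction. *)
Lemma off_minimal_primes_localization (noethR : noetherian R) c :
  off_minimal_primes R c -> off_minimal_primes L (phi c).
Proof.
move=> oc P [pP Pmin] Pc.
have [P' mP' P'P] := minimal_prime_below noethR _ (prime_preimage phi _ pP).
have P'S s : S s -> ~ P' s.
  by move=> Ss /P'P; exact: prime_contract_disjoint.
apply: (oc P') => //; apply: fractions_contract_prime => //; first by case: mP'.
rewrite (Pmin (fractions P')) //; first by apply: fractions_prime => //; case: mP'.
move=> x [r [s [/P'P Pr Ss xE]]]; have : P (x * phi s) by rewrite xE.
by case/(primeM pP) => // /(prime_contract_disjoint _ _ pP Ss).
Qed.

(** Otherwise the products [s * t ^+ n] are all nonzero and some prime avoids them; a minimal prime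
    below it misses both [S] and [t]. *)
Lemma localization_nilpotent (noethR : noetherian R) t :
  (forall P, is_minimal_prime P -> (forall s, S s -> ~ P s) -> P t) ->
  exists n, phi t ^+ n = 0.
Proof.
move=> Pt; apply: contrapT => nnil; have [S1 SM] := multS.
have [|||P [pP _ PM]] := exists_prime_avoiding noethR [set 0]
    [set z | exists2 s, S s & exists n, z = s * t ^+ n].
- exact: ideal_zero.
- split; first by exists 1 => //; exists 0%N; rewrite mul1r.
  move=> _ _ [s Ss [n ->]] [s' Ss' [n' ->]]; exists (s * s'); first exact: SM.
  by exists (n + n')%N; rewrite exprD; ring.
- move=> _ [s Ss [n ->]] /= st0; apply: nnil; exists n.
  apply: (localizationK _ _ s) => //.
  by rewrite mul0r -rmorphXn -rmorphM mulrC st0 rmorph0.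
have [P' mP' P'P] := minimal_prime_below noethR P pP.
apply: (PM t); first by exists 1 => //; exists 1%N; rewrite mul1r expr1.
apply: (P'P); apply: Pt => // s Ss /P'P; apply: PM.
by exists s => //; exists 0%N; rewrite mulr1.
Qed.

(** [d] itself may lie in minimal primes of [R] that meet [S]. The correction [t] takes it out of
    them and becomes nilpotent in [L], where a high Frobenius power erases it. *)
Lemma off_minimal_primes_lift {p : nat} (noethR : noetherian R) d :
  prime p -> p%:R = 0 :> R -> off_minimal_primes L (phi d) ->
  exists e n, off_minimal_primes R e /\ phi e = phi d ^+ (p ^ n)%N.
Proof.
move=> p_prime pR0 od.
have pL0 : p%:R = 0 :> L by rewrite -(rmorph_nat phi) pR0 rmorph0.
have [t tP] := minimal_prime_adjust noethR d.
have [|n tn] := localization_nilpotent noethR t.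
  (* A minimal prime missing [S] extends to a minimal prime of [L], so it cannot contain [d] and
     must contain [t]. *)
  move=> P mP PS; case: (tP P mP) => -[] // Pd _.
  by case: (od _ (fractions_minimal_prime P mP PS)); exact: sub_fractions.
exists ((d + t) ^+ (p ^ n)%N), n; split.
  apply: off_minimal_primesX => P mP Pdt.
  have iP : is_ideal P by case: mP => /prime_ideal.
  case: (tP P mP) => -[Pd Pt].
    apply: Pt; rewrite -(addKr d t) -mulN1r.
    by apply: idealD => //; exact: idealMl.
  apply: Pd; rewrite -(addrK t d) -mulN1r.
  by apply: idealD => //; exact: idealMl.
rewrite rmorphXn rmorphD (frobD p_prime pL0).
have /subnK <- : (n <= p ^ n)%N by rewrite ltnW // ltn_expl // prime_gt1.
by rewrite [phi t ^+ _]exprD tn mulr0 addr0.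
Qed.

Lemma frob_pow_fractions {p : nat} n b : prime p -> p%:R = 0 :> L ->
  is_ideal b -> frob_pow p n (fractions b) `<=` fractions (frob_pow p n b).
Proof.
move=> p_prime pL0 ib; apply: frob_pow_sub.
  exact/fractions_ideal/frob_pow_ideal.
move=> x [r [s [br Ss xE]]]; exists (r ^+ (p ^ n)%N), (s ^+ (p ^ n)%N).
split; [exact: frob_powX|exact: denominatorX|].
by rewrite !rmorphXn -exprMn xE.
Qed.

Lemma tight_closure_fractions {p : nat} (noethR : noetherian R) b :
  prime p -> p%:R = 0 :> L -> is_ideal b ->
  fractions (tight_closure p b) `<=` tight_closure p (fractions b).
Proof.
move=> p_prime pL0 ib x [r [s [[c oc [N cr]] Ss xE]]].
have [unitS _ _] := locL; have [t st] := unitS s Ss.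
rewrite -[x]mulr1 -st mulrA xE.
apply: (idealMr (tight_closure_ideal p_prime pL0 _)).
exists (phi c); first exact: off_minimal_primes_localization.
exists N => n /cr; rewrite -rmorphXn -rmorphM.
move: (c * _); apply: frob_pow_sub.
  exact/ideal_preimage/frob_pow_ideal.
by move=> y yb /=; rewrite rmorphXn; apply: frob_powX; exact: sub_fractions.
Qed.

End Localization.

Arguments fractions {R L} S phi b.

(** * Tight closures in the presence of a weak test element *)

Section WeakTestElement.
Context {p : nat} {R Rinf : comNzRingType} {psi0 : {rmorphism R -> Rinf}}.
Hypotheses (noethR : noetherian R) (charR : p \in [pchar R]).
Hypothesis perfRinf : is_perfect p Rinf.
Variables (a : set R) (a_ : nat -> set R) (I : set Rinf).
Hypothesis ideal_a : is_ideal a.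
Hypothesis a_bounds : forall n,
  frob_pow p n a `<=` a_ n /\ a_ n `<=` tight_closure p (frob_pow p n a).
Hypothesis I_corr : corresponds p psi0 I a_.
Variables (m0 : nat) (c : R).
Hypothesis test_c : is_weak_test_element p m0 c.

Local Notation psi := (psi p psi0).

Let p_prime : prime p := pcharf_prime charR.

Let pR0 : p%:R = 0 :> R := pcharf0 charR.

(* [a_ (n + k)] lies in a tight closure only, so the test element has to be
   applied once more; this replaces the multiplier [e] by [c * e ^+ p ^ m0]. *)
Lemma tight_closure_frob_test n z e N : off_minimal_primes R e ->
  (forall k, (N <= k)%N -> a_ (n + k)%N (e * z ^+ (p ^ k)%N)) ->
  tight_closure p (frob_pow p n a) z.
Proof.
move=> oe ez; have [oc test] := test_c.
exists (c * e ^+ (p ^ m0)%N); first exact/off_minimal_primesM/off_minimal_primesX.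
exists (N + m0)%N => k Nk.
have [j kE Nj] : exists2 j, k = (j + m0)%N & (N <= j)%N.
  exists (k - m0)%N; first by rewrite subnK // (leq_trans (leq_addl _ _) Nk).
  by rewrite -(leq_add2r m0) subnK // (leq_trans (leq_addl _ _) Nk).
have [_ /(_ _ (ez j Nj))] := a_bounds (n + j).
move=> /(proj1 (test _ (frob_pow_ideal _ _) _))/(_ m0 (leqnn _)).
by rewrite !frob_pow_comp // kE addnA exprMn mulrA -exprM -expnD.
Qed.

Definition test_roots : set Rinf := range (fun m => psi m c).

(** Multiplying by [psi (n + k) c] gives the multiplier [c] at every level [n + k]. Conversely the
    test puts fine roots of [c] into the colon, and each [psi m c] is a multiple of such a root. *)
Lemma tight_closure_corresponds :
  corresponds p psi0 [set y | forall d, test_roots d -> I (d * y)]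
    (fun n => tight_closure p (frob_pow p n a)).
Proof.
have [iI aE] := I_corr; have [oc test] := test_c; split.
  split=> [d _|x y Ix Iy d dC|r x Ix d dC].
  - by rewrite mulr0; exact: ideal0.
  - by rewrite mulrDr; apply: idealD => //; [exact: Ix|exact: Iy].
  - by rewrite mulrCA; apply: idealMl => //; exact: Ix.
move=> n; apply/seteqP; split=> r.
  move=> Ir; apply: (tight_closure_frob_test n r c 0%N oc) => k _.
  rewrite -aE /= (psiM perfRinf) (psi_frob perfRinf); apply: Ir.
  by exists (n + k)%N.
move=> /(test _ (frob_pow_ideal _ _)) cr _ [m _ <-].
(* [m0] meets the threshold of the test, and [m] makes the root at least as fine as [psi m c]. *)
have := cr (m + m0)%N (leq_addl _ _); rewrite frob_pow_comp //.
case: (a_bounds (n + (m + m0))) => aa _ /aa.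
rewrite -aE /= (psiM perfRinf) (psi_frob perfRinf) addnCA => Ir.
rewrite -(psi_addnX perfRinf m (n + m0)).
case: (p ^ _)%N (expn_frob_gt0 p_prime (n + m0)) => // q _.
by rewrite exprSr -mulrA; exact: idealMl.
Qed.

Lemma tight_closure_decomposition k (Q : 'I_k -> set Rinf) :
  (forall i, primary_or_whole (Q i)) -> I = \bigcap_i Q i ->
  has_primary_decomposition [set y | forall d, test_roots d -> I (d * y)].
Proof.
move=> pQ IE; apply/has_primary_decompositionP.
exists k, (fun i => [set y | forall d, test_roots d -> Q i (d * y)]).
split=> [i|]; first exact: primary_or_whole_colon.
apply/seteqP; split=> [y Iy i _ d /Iy|y Qy d dC]; rewrite IE; first exact.
by move=> i _; exact: Qy.
Qed.

(** An associated prime of a tight closure is the pullback of the radical of some [Q' i], which is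
    that of [Q i]. Irredundance gives [psi m r] outside [Q i] but in every other [Q j], so the prime
    is associated with [a_ m]; this [m] comes from the witness and may differ from [n]. *)
Lemma ass_tight_closure : has_primary_decomposition I ->
  \bigcup_n ass (tight_closure p (frob_pow p n a)) `<=` \bigcup_n ass (a_ n).
Proof.
move=> /has_primary_decompositionP[k0 [Q0 [pQ0 IE0]]] P [n _].
have [iI aE] := I_corr.
(* Irredundance is only imposed on the union of the images of the [psi m],
   where it is witnessed by an element of [R]. *)
pose D : set Rinf := [set y | exists m r, y = psi m r].
have [|k [Q [pQ DI irr _]]] := minimal_family Rinf primary_or_whole D (D `&` I).
  by exists k0, Q0; rewrite IE0.
have aQ m : a_ m = \bigcap_i (psi m @^-1` Q i).
  rewrite -aE; have DIE r : I (psi m r) = (D `&` I) (psi m r).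
    by apply/propext; split=> [Ir|[]//]; split=> //; exists m, r.
  apply/seteqP; split=> r.
    by rewrite /= DIE DI => -[_ Qr] i _; exact: Qr.
  by move=> Qr; rewrite /= DIE DI; split; [exists m, r|move=> i _; exact: Qr].
pose Q' i := [set y | forall d, test_roots d -> Q i (d * y)].
have pQ' i : primary_or_whole (Q' i) by exact: primary_or_whole_colon.
have [_ tE] := tight_closure_corresponds.
have tQ' : tight_closure p (frob_pow p n a) = \bigcap_i (psi n @^-1` Q' i).
  rewrite -tE; have DIE d r : test_roots d ->
      I (d * psi n r) <-> forall i, Q i (d * psi n r).
    move=> [m _ <-].
    (* [I] and the intersection of the [Q i] are only known to agree on [D]; the common level
       [m + n] shows that the product is in [D]. *)
    have -> : psi m c * psi n r = psi (m + n) (c ^+ (p ^ n)%N * r ^+ (p ^ m)%N).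
      by rewrite (psiM perfRinf) (psi_frob perfRinf) addnC (psi_frob perfRinf).
    move: (_ * _) => z.
    have -> : I (psi (m + n) z) = a_ (m + n)%N z by rewrite -aE.
    by rewrite aQ; split=> [Qz i|Qz i _]; exact: Qz.
  apply/seteqP; split=> r /=; first by move=> Ir i _ d dC; have /(DIE d r dC) := Ir d dC; exact.
  by move=> Qr d dC; apply/(DIE d r dC) => i; exact: (Qr i).
move=> /(ass_psi_preimage perfRinf _ Q' n _ P pQ' tQ')[i prQ' PE].
(* The radical of [Q' i] is prime, so [1] witnesses that the colon is not everything. *)
have rQ' : radical (Q' i) = radical (Q i).
  apply: (radical_colon (Q i) test_roots 1) => // Q1; apply: (prime1 prQ').
  exact: sub_radical.
have /existsNP[y /not_implyP[[[m [r ->]] Qr] Qir]] := irr i.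
exists m => //; apply/assP.
  apply/has_primary_decompositionP; exists k, (fun i => psi m @^-1` Q i).
  by split=> // j; exact: psi_preimage_primary.
have Pm : P = radical (psi m @^-1` Q i).
  rewrite (psi_preimage_radical perfRinf) PE rQ'.
  by rewrite (psi_preimage_prime perfRinf) // -rQ'.
split; first by rewrite PE; exact: prime_preimage.
have [iQ QM] : primary_or_whole (psi m @^-1` Q i) by exact: psi_preimage_primary.
exists r; rewrite Pm; apply/seteqP; split=> x [l].
  move=> Qx; exists l; rewrite /= aQ => j _.
  have [->|ji] := eqVneq j i; first exact: idealMl.
  apply: (idealMr (psi_preimage_ideal perfRinf m _ (proj1 (pQ j)))).
  exact: Qr.
by rewrite /= aQ => /(_ i Logic.I)/QM[//|]; rewrite -{2}radical_idem; exists l.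
Qed.

(** In the hard inclusion each exponent [n] yields its own denominator in [S]; the finitely many
    components of [I] allow a single one for all [n]. *)
Lemma tight_closure_localization (S : set R) (L : comPzRingType) (phi : {rmorphism R -> L}) :
  has_primary_decomposition I -> mult_closed S -> is_localization S phi ->
  ideal_extension phi (tight_closure p a) = tight_closure p (ideal_extension phi a).
Proof.
move=> [k [Q [pQ IE]]] multS locL.
have pL0 : p%:R = 0 :> L by rewrite -(rmorph_nat phi) pR0 rmorph0.
rewrite !(ideal_extensionE multS locL) //; last exact: tight_closure_ideal.
apply/seteqP; split; first exact: tight_closure_fractions.
move=> x tx; have [iI aE] := I_corr; have [S1 SM] := multS.
have [_ frac _] := locL; have [r [s0 [Ss0 xE]]] := frac x.
have : tight_closure p (fractions S phi a) (phi r).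
  by rewrite -xE; apply: (idealMr (tight_closure_ideal p_prime pL0 _)).
(* The multiplier [d] is replaced by its numerator, then by an [e] from [R], at the cost of a
   Frobenius power. *)
move=> [d od [N dr]]; have [d' [s1 [Ss1 dE]]] := frac d.
have od' : off_minimal_primes L (phi d').
  rewrite -dE => P mP; have [pP _] := mP; case/(primeM pP); first exact: od.
  exact: (prime_contract_disjoint locL _ _ pP Ss1).
have [e [M [oe eE]]] := off_minimal_primes_lift multS locL noethR d' p_prime pR0 od'.
have er n : (N <= n)%N -> exists2 s, S s & I (psi n s * (psi n e * psi0 r)).
  move=> Nn; have : fractions S phi (frob_pow p n a) (phi (e * r ^+ (p ^ n)%N)).
    apply: (frob_pow_fractions multS locL n a p_prime pL0 ideal_a).
    rewrite rmorphM rmorphXn eE -dE.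
    case: (p ^ M)%N (expn_frob_gt0 p_prime M) => // q _.
    rewrite exprSr [d * _]mulrC -!mulrA mulrA.
    by apply: (idealMl (frob_pow_ideal _ _)); exact: dr.
  case/(fractions_contract multS locL _ _ (frob_pow_ideal _ _)) => s Ss.
  case: (a_bounds n) => aa _ /aa; rewrite -aE /= !(psiM perfRinf) (psi_exp perfRinf).
  by exists s.
(* Either a power of some [s] kills the component, or every [psi n s] avoids its radical and
   cancels, so that [1] serves. *)
have /choice[s sP] i : exists s, S s /\ forall n, (N <= n)%N ->
    Q i (psi0 s * (psi n e * psi0 r)).
  have [[iQ _] QM] := pQ i.
  have [[s Ss [m Qs]]|PS] := pselect (exists2 s, S s & radical (Q i) (psi0 s)).
    exists (s ^+ m); split=> [|n _]; first exact: denominatorX.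
    by rewrite rmorphXn; exact: idealMr.
  exists 1; split=> // n /er[s Ss]; rewrite IE rmorph1 mul1r mulrC.
  move=> /(_ i Logic.I)/QM[//|Qs]; case: PS; exists s => //.
  have prQ := radical_prime _ (pQ i).
  have psE := psi_preimage_prime perfRinf n _ prQ.
  by suff: (psi0 @^-1` radical (Q i)) s by []; rewrite -psE.
exists (\prod_i s i * r), (\prod_i s i * s0); split.
- rewrite -(frob_pow0 (p := p) a ideal_a).
  apply: (tight_closure_frob_test 0 _ e N oe) => n Nn.
  rewrite add0n -aE /= (psiM perfRinf) (psi_exp perfRinf) IE => i _.
  rewrite (bigD1 i) //= !rmorphM.
  set w := psi0 (\prod_(j | _) _).
  have -> : psi n e * (psi0 (s i) * w * psi0 r) =
      w * (psi0 (s i) * (psi n e * psi0 r)) by ring.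
  by apply: idealMl; [case: (pQ i) => -[]|case: (sP i) => _; exact].
- by apply: SM => //; apply: denominator_prod => // i; case: (sP i).
- by rewrite !rmorphM -xE; ring.
Qed.

End WeakTestElement.

Arguments test_roots p {R Rinf} psi0 c.

Theorem theorem7p15 (R : comNzRingType) (p : nat) (R_noeth : noetherian R)
    (R_char : p \in [pchar R])
    (Rinf : comNzRingType) (psi0 : {rmorphism R -> Rinf})
    (Rinf_closure : is_perfect_closure p psi0)
    (a : set R) (a_proper : is_proper_ideal a)
    (a_ : nat -> set R) (a_fseq : f_sequence p a_)
    (a_bounds : forall n : nat,
       frob_pow p n a `<=` a_ n /\
       a_ n `<=` tight_closure p (frob_pow p n a))
    (I : set Rinf) (I_corr : corresponds p psi0 I a_)
    (I_decomp : has_primary_decomposition I) :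
  linear_growth p a_ /\
  finite_set (\bigcup_n ass (a_ n)) /\
  ((exists (m0 : nat) (c : R), is_weak_test_element p m0 c) ->
   (forall S : set R, mult_closed S ->
    forall (L : comPzRingType) (phi : {rmorphism R -> L}),
      is_localization S phi ->
      ideal_extension phi (tight_closure p a) =
      tight_closure p (ideal_extension phi a)) /\
   ((exists J : set Rinf,
       corresponds p psi0 J (fun n => tight_closure p (frob_pow p n a)) /\
       has_primary_decomposition J) /\
    linear_growth p (fun n => tight_closure p (frob_pow p n a))) /\
   (\bigcup_n ass (tight_closure p (frob_pow p n a)) `<=` \bigcup_n ass (a_ n) /\
    finite_set (\bigcup_n ass (tight_closure p (frob_pow p n a))))).
Proof.
have [perfRinf _] := Rinf_closure.
have p_prime := pcharf_prime R_char; have pR0 : p%:R = 0 :> R := pcharf0 R_char.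
have [iI aE] := I_corr; have [ia _] := a_proper.
(* Properness at index [0] gives it at every index: a sequence that corresponds to an ideal has [1]
   in all its terms or in none. *)
have tight1 : ~ tight_closure p (frob_pow p 0 a) 1.
  by rewrite frob_pow0 //; exact: tight_closure_proper.
have a1 : ~ a_ 0%N 1 by case: (a_bounds 0%N) => _ /[apply].
have fin : finite_set (\bigcup_n ass (a_ n)).
  have [k [Q [pQ IE]]] := (has_primary_decompositionP I).1 I_decomp.
  have := finite_image (fun i => psi0 @^-1` radical (Q i)) (@finite_finset _ [set: 'I_k]).
  apply: sub_finite_set.
  move=> P [n _ aP].
  have anE : a_ n = \bigcap_i (psi p psi0 n @^-1` Q i) by rewrite -aE IE preimage_bigcap.
  by have [i _ ->] := ass_psi_preimage perfRinf k Q n (a_ n) P pQ anE aP; exists i.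
split; first exact: linear_growth_of_decomposition I_corr I_decomp a1.
split=> // -[m0 [c test_c]].
have [k [Q [pQ IE]]] := (has_primary_decompositionP I).1 I_decomp.
have assS := ass_tight_closure R_char perfRinf a a_ I a_bounds I_corr m0 c test_c I_decomp.
have corr := tight_closure_corresponds R_char perfRinf a a_ I a_bounds I_corr m0 c test_c.
have decomp := tight_closure_decomposition (psi0 := psi0) (p := p) I c k Q pQ IE.
split; last split; last by split=> //; exact: sub_finite_set fin.
  move=> S multS L phi locL.
  exact: (tight_closure_localization R_noeth R_char perfRinf a a_ I ia a_bounds
    I_corr m0 c test_c S L phi I_decomp multS locL).
split; first by exists [set y | forall d, test_roots p psi0 c d -> I (d * y)].
exact: linear_growth_of_decomposition corr decomp tight1.
Qed.
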